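(* Let $\mathcal{M}=\{v_1,\ldots,v_k\}$, $v_i\in\{0,1\}^k$, be a graphic matroid (of a simple graph). Then the property of being $\mathcal{M}$-free is locally testable. Specifically, there exist a function $\tau:\mathbb{R}^+\to\mathbb{R}^+$ (not depending on $n$) and a $k$-query tester which, for every positive integer $n$, given oracle access to $f:\{0,1\}^n\to\{0,1\}$, accepts with probability one if $f$ is $\mathcal{M}$-free, and, for every $\epsilon>0$, rejects with probability at least $\tau(\epsilon)$ if $f$ is $\epsilon$-far from being $\mathcal{M}$-free.
   Context: $\{0,1\}$ is identified with the field $\mathbb{F}_2$, and $\{0,1\}^n$ with the vector space $\mathbb{F}_2^n$; linear means $\mathbb{F}_2$-linear. A binary matroid $\mathcal{M}$ on $k$ elements is represented by vectors $v_1,\ldots,v_k\in\{0,1\}^k$. It is graphic if there is a simple graph $G$ (no self-loops, no parallel edges) with $k$ edges, associated bijectively with $v_1,\ldots,v_k$, such that a subset of the $v_i$ is linearly dependent if and only if the associated set of edges contains a cycle. A function $f:\{0,1\}^n\to\{0,1\}$ is $\mathcal{M}$-free if for every linear map $L:\{0,1\}^k\to\{0,1\}^n$, $\langle f(L(v_1)),\ldots,f(L(v_k))\rangle\neq 1^k$ (the all-ones string). $\mathcal{F}_{\mathcal{M}}$ denotes the family of $\mathcal{M}$-free functions (for each $n$). For $f,g:\{0,1\}^n\to\{0,1\}$, $\delta(f,g)=\Pr_x[f(x)\ne g(x)]$ with $x$ uniform in $\{0,1\}^n$; for a family $\mathcal{F}$, $\delta(f,\mathcal{F})=\min_{g\in\mathcal{F}}\delta(f,g)$;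 $f$ is $\epsilon$-far from $\mathcal{F}$ if $\delta(f,\mathcal{F})\ge\epsilon$. A $k$-query tester is a randomized procedure that queries $f$ at (at most) $k$ points and then accepts or rejects. *)

(* Defs.v *)
From mathcomp Require Import all_boot all_order all_algebra.
From mathcomp Require Import boolp reals.

Set Implicit Arguments.
Unset Strict Implicit.
Unset Printing Implicit Defensive.

Import Order.TTheory GRing.Theory Num.Theory.
Local Open Scope ring_scope.

Record sgraph := SGraph {
  vertex :> finType;
  adj : rel vertex;
  adj_sym : symmetric adj;
  adj_irr : irreflexive adj }.

Definition edges (G : sgraph) : {set {set G}} :=
  [set [set p.1; p.2] | p : G * G & adj p.1 p.2].

(* As there are neither loops nor parallel edges, a cycle visits at least
   three vertices. *)
Definition contains_cycle (V : finType) (E : {set {set V}}) : Prop :=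
  exists2 p : seq V, (2 < size p)%N & ucycle (fun x y => [set x; y] \in E) p.

(* [free] is linear independence of a sequence, so two equal vectors with
   distinct indices in [S] count as dependent. *)
Definition graphic (k : nat) (v : 'I_k -> 'rV['F_2]_k) : Prop :=
  exists (G : sgraph) (edge : 'I_k -> {set G}),
    [/\ injective edge,
        edge @: [set: 'I_k] = edges G
      & forall S : {set 'I_k},
          ~~ free [seq v i | i in S] <-> contains_cycle (edge @: S)].

Definition boolfun (n : nat) := {ffun 'rV['F_2]_n -> bool}.

Definition matroid_free (k : nat) (v : 'I_k -> 'rV['F_2]_k) (n : nat)
    (f : boolfun n) : Prop :=
  forall L : {linear 'rV['F_2]_k -> 'rV['F_2]_n},
    [tuple f (L (v i)) | i < k] <> [tuple true | _ < k].

Definition dist (R : realType) (n : nat) (f g : boolfun n) : R :=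
  #|[set x | f x != g x]|%:R / #|{: 'rV['F_2]_n}|%:R.

(* Distances are at most 1, so the default value 1 only matters if [F] is
   empty. *)
Definition dist_to (R : realType) (n : nat) (f : boolfun n)
    (F : boolfun n -> Prop) : R :=
  \big[Num.min/1]_(g : boolfun n | `[< F g >]) dist R f g.

Definition far (R : realType) (n : nat) (eps : R) (f : boolfun n)
    (F : boolfun n -> Prop) : Prop :=
  eps <= dist_to R f F.

(* Deterministic, possibly adaptive, query algorithms on oracles [D -> bool];
   the answer [true] means acceptance. *)
Inductive qalg (D : Type) : Type :=
  | Answer of bool
  | Query of D & (bool -> qalg D).

Fixpoint run (D : Type) (f : D -> bool) (t : qalg D) : bool :=
  match t with
  | Answer b => b
  | Query x next => run f (next (f x))
  end.

Fixpoint queries (D : Type) (t : qalg D) : nat :=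
  match t with
  | Answer _ => 0
  | Query _ next => (maxn (queries (next true)) (queries (next false))).+1
  end.

(* The randomness is drawn before the first query; for query algorithms this
   is no loss of generality, and neither is the finiteness of the coin space
   when [D] is finite, as only finitely many algorithms make at most [q]
   queries. *)
Record tester (R : realType) (D : Type) (q : nat) := Tester {
  coins : finType;
  weight : coins -> R;
  weight_ge0 : forall w, 0 <= weight w;
  weight_sum1 : \sum_w weight w = 1;
  strategy : coins -> qalg D;
  strategy_queries : forall w, (queries (strategy w) <= q)%N }.
Arguments strategy {R D q} T w : rename.

Definition pr_accept (R : realType) (D : Type) (q : nat) (T : tester R D q)
    (f : D -> bool) : R :=
  \sum_(w | run f (strategy T w)) weight w.

Definition pr_reject (R : realType) (D : Type) (q : nat) (T : tester R D q)
    (f : D -> bool) : R :=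
  \sum_(w | ~~ run f (strategy T w)) weight w.

(* Main.v *)
Require Import Defs.
From mathcomp Require Import all_boot all_order all_algebra.
From mathcomp Require Import boolp reals.
From mathcomp Require Import ring lra.

(** Let [G] be a graph representing the matroid, with vertex set [V].  Since the
    zero sums of the [v i] are exactly the even subgraphs of [G], prescribing a
    linear map [L] on the [v i] is the same as prescribing a potential
    [y : V -> F_2^n], the value on the edge [uw] being [y w - y u].  Hence [f] is
    free iff [G] has no homomorphism to the Cayley graph of [f], in which [x] and
    [x'] are joined when [f (x' - x)] ([graphic_freeP]).  The tester draws [y]
    uniformly and queries [f] at the [k] differences; it rejects with
    probability exactly the homomorphism density of [G].

    So it has to be shown that, if that density is small, few changes to [f]
    destroy all homomorphisms.  By the graph removal lemma ([graph_removal]) there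
    is a sparse set [D] of pairs meeting every homomorphism.  Following Kral',
    Serra and Vena, delete from [f] each [x] such that a fraction at least [1/k]
    of the translates [(z, z + x)] lies in [D]; as [D] is sparse, there are few
    such [x].  If a homomorphism [y] survived, each of its [#|U|] translates would
    meet [D] in one of the [k] edges, so for some edge a fraction [1/k] of the
    translates would lie in [D], and the value at that edge would have been
    deleted ([cayley_removal]).

    The removal lemma is proved from Szemeredi's regularity lemma in its energy
    increment form ([energy_increment], [regularity_lemma]), for partitions whose
    parts need not have equal sizes: pairs meeting a small part, irregular pairs
    and pairs of low density go into [D].  A homomorphism avoiding [D] lies in
    parts that are large, pairwise regular and dense along the edges of [G], and
    the counting lemma ([counting_lemma]) then produces many homomorphisms. *)

Set Implicit Arguments.
Unset Strict Implicit.
Unset Printing Implicit Defensive.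

Import Order.TTheory GRing.Theory Num.Theory.
Local Open Scope ring_scope.

(** * Conditional averages and energy *)

Section Average.
Variables (R : realFieldType) (Z : finType).
Implicit Types h : Z -> R.

(** The value is 0 on colours that are not used. *)
Definition average (T : finType) (C : Z -> T) h (t : T) : R :=
  (\sum_(z | C z == t) h z) / #|[set z | C z == t]|%:R.

Definition energy (T : finType) (C : Z -> T) h : R :=
  \sum_z average C h (C z) ^+ 2.

(** Tower rule: conditional averaging is self-adjoint and fixes the functions
    that are constant on colour classes. *)
Lemma sum_average (T : finType) (C : Z -> T) h (phi : T -> R) :
  \sum_z average C h (C z) * phi (C z) = \sum_z h z * phi (C z).
Proof.
rewrite (partition_big C predT) //= [RHS](partition_big C predT) //=.
apply: eq_bigr => t _.
rewrite (eq_bigr (fun=> average C h t * phi t)); last by move=> z /eqP ->.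
rewrite [RHS](eq_bigr (fun z => h z * phi t)); last by move=> z /eqP ->.
rewrite big_const iter_addr_0 -mulr_suml -mulrnAl; congr (_ * _).
rewrite /average cardsE -mulr_natr; have [/card0_eq C0|nz] := posnP #|[pred z | C z == t]|.
  by rewrite big_pred0 ?mul0r // => z; have := C0 z; rewrite inE.
by rewrite divfK // pnatr_eq0 -lt0n.
Qed.

Lemma average_bounds (T : finType) (C : Z -> T) h t :
  (forall z, 0 <= h z <= 1) -> 0 <= average C h t <= 1.
Proof.
move=> h01; have s0 : 0 <= \sum_(z | C z == t) h z.
  by apply: sumr_ge0 => z _; case/andP: (h01 z).
rewrite divr_ge0 //=.
have [c0|cp] := posnP #|[set z | C z == t]|.
  by rewrite /average c0 invr0 mulr0.
rewrite ler_pdivrMr ?ltr0n // mul1r cardsE -sumr_const.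
by apply: ler_sum => z _; case/andP: (h01 z).
Qed.

Lemma energy_le (T : finType) (C : Z -> T) h :
  (forall z, 0 <= h z <= 1) -> energy C h <= #|Z|%:R.
Proof.
move=> h01; rewrite -sumr_const; apply: ler_sum => z _.
by have /andP[a0 a1] := average_bounds C (C z) h01; rewrite expr_le1.
Qed.

(** Pythagoras: averages over a coarser colouring are the orthogonal projection of
    averages over a finer one. *)
Lemma energy_refine (T T' : finType) (C : Z -> T) (C' : Z -> T') (pi : T' -> T) h :
  (forall z, pi (C' z) = C z) ->
  energy C' h = energy C h
    + \sum_z (average C' h (C' z) - average C h (C z)) ^+ 2.
Proof.
move=> piC.
have E : \sum_z average C' h (C' z) * average C h (C z) = energy C h.
  transitivity (\sum_z h z * average C h (C z)).
    have := sum_average C' h (fun t' => average C h (pi t')).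
    by under eq_bigr do rewrite piC; under [in RHS]eq_bigr do rewrite piC.
  by rewrite -(sum_average C h (average C h)); apply: eq_bigr => z _; rewrite expr2.
under [X in _ + X]eq_bigr do rewrite sqrrB.
by rewrite big_split /= sumrB sumrMnl E /energy; ring.
Qed.

(** A large sum over part of [W] forces a large second moment on [W].  Applied to
    [g], the change of the local density under refinement, this turns a witness of
    irregularity into an energy gain. *)
Lemma sum_sqr_ge (U W : {set Z}) (g : Z -> R) (eps : R) :
    U \subset W -> 0 <= eps -> eps * #|W|%:R <= `|\sum_(z in U) g z| ->
  eps ^+ 2 * #|W|%:R <= \sum_(z in W) g z ^+ 2.
Proof.
move=> sUW eps0 big.
(* the tangent line at [t] lies below the parabola *)
have tangent t : 2 * t * (\sum_(z in U) g z) - t ^+ 2 * #|W|%:R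
    <= \sum_(z in W) g z ^+ 2.
  rewrite [X in _ <= X](big_setID U) /= (setIidPr sUW).
  rewrite -(cardsID U W) (setIidPr sUW) natrD mulrDr opprD addrA.
  have -> : t ^+ 2 * #|U|%:R = \sum_(z in U) t ^+ 2.
    by rewrite sumr_const mulr_natr.
  rewrite mulr_sumr -sumrB; apply: lerD.
    by apply: ler_sum => z _; have := sqr_ge0 (g z - t); rewrite sqrrB; nra.
  apply: (@le_trans _ _ 0); first by rewrite oppr_le0 mulr_ge0 ?sqr_ge0.
  by apply: sumr_ge0 => z _; apply: sqr_ge0.
move: big; have [s0|s0] := ger0P (\sum_(z in U) g z) => big.
  by apply: le_trans (tangent eps); nra.
by apply: le_trans (tangent (- eps)); nra.
Qed.
End Average.

(** * Regularity by energy increment *)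

Section Regularity.
Variables (R : realType) (X : finType) (W : X -> X -> R).

(** The error is relative to [P] and [Q] rather than to [S] and [S'], so that small
    subsets need no separate treatment; [d] stands for the density of the pair. *)
Definition regular_pair (eps d : R) (P Q : {set X}) : bool :=
  [forall S : {set X}, forall S' : {set X}, (S \subset P) && (S' \subset Q) ==>
     (`|\sum_(x in S) \sum_(y in S') (W x y - d)| <= eps * #|P|%:R * #|Q|%:R)].

Definition part (T : finType) (c : X -> T) (t : T) : {set X} := [set x | c x == t].

Definition colour2 (T : finType) (c : X -> T) (z : X * X) : T * T := (c z.1, c z.2).

Definition density (T : finType) (c : X -> T) : T * T -> R :=
  average (colour2 c) (fun z => W z.1 z.2).

Definition irregular (eps : R) (T : finType) (c : X -> T) (t : T * T) : bool :=
  ~~ regular_pair eps (density c t) (part c t.1) (part c t.2).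

Definition irregular_pairs (eps : R) (T : finType) (c : X -> T) : {set X * X} :=
  [set z | irregular eps c (colour2 c z)].

(** The common refinement of [c] and all witness sets: [w (t, t')] is a pair of
    subsets of the parts [t] and [t'], and the new colour of [x] records in which
    of the sets it lies. *)
Definition split_colour (T : finType) (c : X -> T) (w : T * T -> {set X} * {set X})
    (x : X) : T * {ffun T -> bool * bool} :=
  (c x, [ffun t => (x \in (w (c x, t)).1, x \in (w (t, c x)).2)]).

Definition energy2 (T : finType) (c : X -> T) : R :=
  energy (colour2 c) (fun z => W z.1 z.2).

(** Split every part by all witnesses of irregularity.  On the
    witness rectangle of an irregular cell the new averages differ from the old
    one by a total of at least [eps] times the size of the cell, so by [sum_sqr_ge] the cell contributes [eps ^+ 2] times its
    size to the energy. *)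
Lemma energy_increment (eps alpha : R) (T : finType) (c : X -> T) :
    0 <= eps -> alpha * #|X|%:R ^+ 2 < #|irregular_pairs eps c|%:R ->
  exists w, energy2 c + eps ^+ 2 * alpha * #|X|%:R ^+ 2 <= energy2 (split_colour c w).
Proof.
move=> eps0 irr.
have /fin_all_exists[w wP] (t : T * T) : exists s : {set X} * {set X},
    irregular eps c t -> [/\ s.1 \subset part c t.1, s.2 \subset part c t.2
    & eps * #|part c t.1|%:R * #|part c t.2|%:R
      < `|\sum_(x in s.1) \sum_(y in s.2) (W x y - density c t)|].
  have [|_] := boolP (irregular eps c t); last by exists (set0, set0).
  rewrite /irregular negb_forall => /existsP[S]; rewrite negb_forall => /existsP[S'].
  by rewrite negb_imply -ltNge -andbA => /and3P[? ? ?]; exists (S, S').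
exists w; set c' := split_colour c w.
pose pi (t : (T * {ffun T -> bool * bool}) * (T * {ffun T -> bool * bool})) :=
  (t.1.1, t.2.1).
rewrite /energy2 (@energy_refine _ _ _ _ (colour2 c) (colour2 c') pi) // lerD2l.
rewrite (partition_big (colour2 c) predT) //=.
apply: (@le_trans _ _ (\sum_(t | irregular eps c t)
    eps ^+ 2 * #|[set z | colour2 c z == t]|%:R)).
  rewrite -mulr_sumr -mulrA ler_wpM2l ?sqr_ge0 // (le_trans (ltW irr)) //.
  rewrite -natr_sum ler_nat /irregular_pairs -sum1_card.
  rewrite (partition_big (colour2 c) (irregular eps c)) /=; last first.
    by move=> z; rewrite inE.
  apply: leq_sum => t irt; rewrite -sum1_card.
  by apply: eq_leq; apply: eq_bigl => z; rewrite !inE; case: eqP => [->|]; rewrite ?irt ?andbF.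
rewrite big_mkcond /=; apply: ler_sum => -[i j] _.
case: ifP => [/wP /= [sS sS' bad]|_]; last by apply: sumr_ge0 => z _; apply: sqr_ge0.
pose g z := average (colour2 c') (fun z => W z.1 z.2) (colour2 c' z)
  - average (colour2 c) (fun z => W z.1 z.2) (colour2 c z).
have -> : \sum_(z | colour2 c z == (i, j)) g z ^+ 2
        = \sum_(z in [set z | colour2 c z == (i, j)]) g z ^+ 2.
  by apply: eq_bigl => z; rewrite inE.
have cellE : [set z | colour2 c z == (i, j)] = setX (part c i) (part c j).
  by apply/setP => -[x y]; rewrite !inE /colour2 xpair_eqE.
rewrite cellE; apply: (@sum_sqr_ge _ _ (setX (w (i, j)).1 (w (i, j)).2)) => //.
  by rewrite setXS.
rewrite cardsX natrM mulrA; apply: (le_trans (ltW bad)).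
suff -> : \sum_(x in (w (i, j)).1) \sum_(y in (w (i, j)).2) (W x y - density c (i, j))
    = \sum_(z in setX (w (i, j)).1 (w (i, j)).2) g z by [].
rewrite pair_big /=.
under eq_bigl do rewrite -in_setX -surjective_pairing.
rewrite sumrB /g sumrB; congr (_ - _); last first.
  apply: eq_bigr => -[x y]; rewrite in_setX => /andP[/(subsetP sS) + /(subsetP sS')].
  by rewrite !inE /colour2 => /eqP -> /eqP ->.
(* The indicator of the witness rectangle factors through the new colours, so
   the tower rule replaces the new averages on it by [W]. *)
pose phi (t : (T * {ffun T -> bool * bool}) * (T * {ffun T -> bool * bool})) : R :=
  ((pi t == (i, j)) && ((t.1.2 j).1 && (t.2.2 i).2))%:R.
have phiE z : (z \in setX (w (i, j)).1 (w (i, j)).2)%:R = phi (colour2 c' z).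
  case: z => x y; congr (_%:R); rewrite /= in_setX !ffunE /pi /= xpair_eqE.
  apply: congr1; apply/idP/idP.
    case/andP=> xS yS'; have := subsetP sS _ xS; have := subsetP sS' _ yS'.
    by rewrite !inE => /eqP -> /eqP ->; rewrite !eqxx xS yS'.
  by case/andP=> /andP[/eqP -> /eqP ->].
rewrite big_mkcond [RHS]big_mkcond /=.
transitivity (\sum_z W z.1 z.2 * phi (colour2 c' z)).
  by apply: eq_bigr => z _; rewrite -phiE; case: ifP; rewrite ?mulr1 ?mulr0.
rewrite -(sum_average (colour2 c')).
by apply: eq_bigr => z _; rewrite -phiE; case: ifP; rewrite ?mulr1 ?mulr0.
Qed.

Lemma energy2_le (T : finType) (c : X -> T) :
  (forall x y, 0 <= W x y <= 1) -> energy2 c <= #|X|%:R ^+ 2.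
Proof. by move=> W01; rewrite -natrX -mulnn -card_prod; apply: energy_le => z; apply: W01. Qed.

End Regularity.

(** A part is split by two sets for each of the [M] parts, hence into [4 ^ M]
    pieces. *)
Fixpoint colour_bound (j : nat) : nat :=
  if j is j'.+1 then colour_bound j' * 4 ^ colour_bound j' else 1%N.

(** The normalised energy is at most 1 and grows by [eps ^+ 2 * alpha] with each
    refinement, so refining stops after a number of steps, and hence with a number
    of parts, that depends only on [eps] and [alpha]. *)
Lemma regularity_lemma (R : realType) (eps alpha : R) :
    0 < eps -> 0 < alpha ->
  exists M : nat, forall (X : finType) (W : X -> X -> R),
    (0 < #|X|)%N -> (forall x y, 0 <= W x y <= 1) ->
  exists (T : finType) (c : X -> T),
    (#|T| <= M)%N /\ #|irregular_pairs W eps c|%:R <= alpha * #|X|%:R ^+ 2.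
Proof.
move=> eps0 alpha0; set b := eps ^+ 2 * alpha.
have b0 : 0 < b by rewrite mulr_gt0 ?exprn_gt0.
pose j := Num.bound b^-1.
have jb : 1 < j%:R * b.
  rewrite -ltr_pdivrMr // mul1r; apply: le_lt_trans (archi_boundP _).
    by [].
  by rewrite invr_ge0 ltW.
exists (colour_bound j) => X W X0 W01.
have step i : exists (T : finType) (c : X -> T), (#|T| <= colour_bound i)%N /\
    (#|irregular_pairs W eps c|%:R <= alpha * #|X|%:R ^+ 2
     \/ i%:R * b * #|X|%:R ^+ 2 <= energy2 W c).
  elim: i => [|i [T [c [cT [reg|en]]]]].
  - exists unit, (fun=> tt); rewrite card_unit; split=> //; right.
    by rewrite !mul0r; apply: sumr_ge0 => z _; apply: sqr_ge0.
  - exists T, c; split; last by left.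
    by apply: (leq_trans cT) => /=; rewrite leq_pmulr // expn_gt0.
  have [reg|irr] := lerP #|irregular_pairs W eps c|%:R (alpha * #|X|%:R ^+ 2).
    exists T, c; split; last by left.
    by apply: (leq_trans cT) => /=; rewrite leq_pmulr // expn_gt0.
  have [w wP] := energy_increment (ltW eps0) irr.
  exists (T * {ffun T -> bool * bool})%type, (split_colour c w); split; last first.
    by right; apply: le_trans wP; rewrite -natr1 !mulrDl mul1r lerD2r.
  rewrite card_prod card_ffun card_prod card_bool /= leq_mul //.
  by rewrite leq_exp2l.
have [T [c [cT [reg|en]]]] := step j; exists T, c; split=> //.
have := le_trans en (energy2_le c W01).
have N0 : 0 < #|X|%:R ^+ 2 :> R by rewrite exprn_gt0 // ltr0n.
by rewrite -{2}[_ ^+ 2]mul1r ler_pM2r // leNgt jb.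
Qed.

(** * Counting homomorphisms into regular pairs *)

Section Resample.
Variables (V X : finType).
Implicit Types (y : {ffun V -> X}) (u w : V) (x : X).

Definition resample y u x : {ffun V -> X} := [ffun v => if v == u then x else y v].

Lemma resample_at y u x : resample y u x u = x.
Proof. by rewrite ffunE eqxx. Qed.

Lemma resample_off y u x v : v != u -> resample y u x v = y v.
Proof. by rewrite ffunE => /negPf ->. Qed.

Lemma resampleC y u w x x' : u != w ->
  resample (resample y u x) w x' = resample (resample y w x') u x.
Proof.
move=> uw; apply/ffunP => v; rewrite !ffunE.
by case: (eqVneq v w) => // ->; rewrite eq_sym (negPf uw).
Qed.

Definition box (P : V -> {set X}) : {set {ffun V -> X}} :=
  [set y : {ffun V -> X} | [forall u, y u \in P u]].

Lemma card_box P : #|box P| = (\prod_u #|P u|)%N.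
Proof.
have -> : #|box P| = #|family (fun u => mem (P u))|.
  by rewrite cardsE; apply: eq_card => y; rewrite !inE.
by rewrite card_family foldrE big_image.
Qed.

(** Exchanging the coordinate [y u] with the fresh value [x] is an involution of
    the pairs [(y, x)]. *)
Lemma sum_resample (R : realFieldType) (P : V -> {set X}) (F : {ffun V -> X} -> R) u :
  \sum_(y in box P) \sum_(x in P u) F (resample y u x)
    = #|P u|%:R * \sum_(y in box P) F y.
Proof.
pose swap (p : {ffun V -> X} * X) := (resample p.1 u p.2, p.1 u).
have swapK : involutive swap.
  case=> y x; rewrite /swap /= resample_at; congr pair.
  by apply/ffunP => v; rewrite !ffunE; case: eqP => // ->.
rewrite pair_big /= (reindex_inj (can_inj swapK)) /=.
rewrite (eq_bigl (fun p => (p.1 \in box P) && (p.2 \in P u))); last first.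
  case=> y x /=; rewrite !inE; apply/andP/andP => -[/forallP yP xP]; split.
  - apply/forallP => v; have := yP v.
    by rewrite ffunE; case: (eqVneq v u) => // ->.
  - by have := yP u; rewrite resample_at.
  - by apply/forallP => v; rewrite ffunE; case: (eqVneq v u) => // ->.
  - exact: yP.
rewrite (eq_bigr (fun p => F p.1)); last first.
  by move=> p _; have := congr1 fst (swapK p) => /= ->.
rewrite -(pair_big (mem (box P)) (mem (P u)) (fun y _ => F y)) /= mulr_sumr.
by apply: eq_bigr => y _; rewrite sumr_const mulr_natl.
Qed.

End Resample.

Section Counting.
Variables (R : realType) (V X : finType) (A : rel X).
Let W x y : R := (A x y)%:R.

Definition hom_on (E : seq (V * V)) (y : {ffun V -> X}) : bool :=
  all (fun e => A (y e.1) (y e.2)) E.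

(** Averaging over fresh values of the coordinates [u] and [w] reduces the claim to
    fixed values of all other coordinates, where [a] and [b] become indicators of
    a set of values at [u] and of a set of values at [w]: exactly the situation
    that regularity controls. *)
Lemma discrepancy (eps d : R) (P : V -> {set X}) (u w : V) (a b : pred {ffun V -> X}) :
    u != w -> regular_pair W eps d (P u) (P w) ->
    (forall y x, a (resample y w x) = a y) ->
    (forall y x, b (resample y u x) = b y) ->
  `|\sum_(y in box P) (W (y u) (y w) - d) * (a y && b y)%:R| <= eps * #|box P|%:R.
Proof.
move=> uw /forallP reg aw bu.
have [n0|npos] := posnP (#|P u| * #|P w|)%N.
  have -> : box P = set0.
    apply/setP => y; rewrite !inE; apply/negP => /forallP yP.
    have : (0 < #|P u| * #|P w|)%N.
      by rewrite muln_gt0; apply/andP; split; apply/card_gt0P; eexists; apply: yP.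
    by rewrite n0.
  by rewrite big_set0 cards0 normr0 mulr0.
pose F (y : {ffun V -> X}) := (W (y u) (y w) - d) * (a y && b y)%:R.
rewrite -[\sum_(y in box P) _]/(\sum_(y in box P) F y).
have nR : 0 < (#|P u| * #|P w|)%:R :> R by rewrite ltr0n.
rewrite -(ler_pM2l nR) -{1}(ger0_norm (ltW nR)) -normrM natrM -mulrA.
rewrite -(sum_resample P F w) -(sum_resample P _ u).
apply: le_trans (ler_norm_sum _ _ _) _.
have -> : #|P u|%:R * #|P w|%:R * (eps * #|box P|%:R)
    = \sum_(y in box P) eps * #|P u|%:R * #|P w|%:R.
  by rewrite sumr_const -[in RHS]mulr_natr; ring.
apply: ler_sum => y _.
pose S := [set x in P u | a (resample y u x)].
pose S' := [set x in P w | b (resample y w x)].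
have /forallP/(_ S')/implyP := reg S.
have sS : S \subset P u by apply/subsetP => x; rewrite inE => /andP[].
have sS' : S' \subset P w by apply/subsetP => x; rewrite inE => /andP[].
rewrite sS sS' => /(_ isT); apply: le_trans; rewrite le_eqVlt; apply/orP; left.
apply/eqP; congr `|_|.
have inS x : (x \in S) = (x \in P u) && a (resample y u x) by rewrite inE.
have inS' x : (x \in S') = (x \in P w) && b (resample y w x) by rewrite inE.
rewrite [RHS](eq_bigl _ _ inS) big_mkcondr; apply: eq_bigr => x xP.
case: ifP => ax; last first.
  by apply: big1 => x' _; rewrite /F aw ax mulr0.
rewrite [RHS](eq_bigl _ _ inS') big_mkcondr; apply: eq_bigr => x' x'P.
rewrite /F aw ax resampleC // bu resample_at resample_off 1?eq_sym // resample_at /=.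
by case: ifP; rewrite ?mulr1 ?mulr0.
Qed.

(** Replace the edges one at a time by their densities.  In a simple graph an edge
    other than [uw] misses [u] or misses [w], so the remaining edges split as
    required by [discrepancy], and each replacement costs at most
    [eps * #|box P|]. *)
Lemma counting_lemma (eps : R) (d : V -> V -> R) (P : V -> {set X}) (E : seq (V * V)) :
    0 <= eps -> (forall u w, 0 <= d u w <= 1) ->
    (forall e, e \in E -> e.1 != e.2) -> uniq [seq [set e.1; e.2] | e <- E] ->
    (forall e, e \in E -> regular_pair W eps (d e.1 e.2) (P e.1) (P e.2)) ->
  `|\sum_(y in box P) (hom_on E y)%:R - #|box P|%:R * \prod_(e <- E) d e.1 e.2|
    <= (size E)%:R * eps * #|box P|%:R.
Proof.
move=> eps0 d01; elim: E => [|[u w] E IH] loop.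
  move=> _ _; rewrite big_nil mulr1 !mul0r.
  by rewrite -natr_sum sum1_card subrr normr0.
rewrite [map _ _]/= cons_uniq => /andP[newE uE] reg.
have uw : u != w by apply: (loop (u, w)); rewrite mem_head.
have sE e : e \in E -> e \in (u, w) :: E by move=> eE; rewrite inE eE orbT.
have {IH} IH := IH (fun e eE => loop e (sE e eE)) uE (fun e eE => reg e (sE e eE)).
have regE : regular_pair W eps (d u w) (P u) (P w) by apply: (reg (u, w)); rewrite mem_head.
(* [a] collects the edges missing [w], [b] those through [w], which miss [u]. *)
pose at_w e := (e.1 == w) || (e.2 == w) : bool.
pose a (y : {ffun V -> X}) := hom_on [seq e <- E | ~~ at_w e] y.
pose b (y : {ffun V -> X}) := hom_on [seq e <- E | at_w e] y.
have abE y : hom_on E y = a y && b y.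
  rewrite /a /b /hom_on !all_filter -all_predI; apply: eq_all => e /=.
  by case: (at_w e); rewrite /= ?andbT ?andbT.
have aw y x : a (resample y w x) = a y.
  apply: eq_in_all => e; rewrite mem_filter negb_or => /andP[/andP[e1 e2] _].
  by rewrite !resample_off.
have bu y x : b (resample y u x) = b y.
  apply: eq_in_all => e; rewrite mem_filter => /andP[ew eE].
  have eNu : (e.1 != u) && (e.2 != u).
    rewrite -negb_or; apply: contra newE => eu; apply/mapP; exists e => //=.
    case: e ew eu {eE} => e1 e2; rewrite /at_w /=.
    by case/orP => /eqP -> /orP[] /eqP eu; first [by rewrite eu eqxx in uw|rewrite eu // setUC].
  by case/andP: eNu => ? ?; rewrite !resample_off.
have := discrepancy uw regE aw bu.
rewrite big_cons /= /W; under eq_bigr do rewrite -abE mulrBl -natrM mulnb.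
rewrite sumrB -mulr_sumr.
have /andP[d0 d1] := d01 u w.
move: IH; set s := \sum_(y in _) _; set p := \prod_(e <- E) _; set B := #|_|%:R.
set t := \sum_(y in _) _ => IH disc.
have -> : \sum_(y in box P) (hom_on ((u, w) :: E) y)%:R - B * (d u w * p)
        = (t - d u w * s) + d u w * (s - B * p) by rewrite -/t; ring.
apply: (le_trans (ler_normD _ _)); rewrite -natr1 !mulrDl mul1r addrC lerD //.
rewrite normrM (ger0_norm d0); apply: le_trans IH.
by rewrite ler_piMl.
Qed.

End Counting.

(** * The graph removal lemma *)

Lemma card_small_parts (R : realType) (X T : finType) (c : X -> T) (b : R) :
    0 <= b ->
  #|[set x | #|part c (c x)|%:R < b]|%:R <= #|T|%:R * b.
Proof.
move=> b0; rewrite -sum1_card natr_sum (partition_big c predT) //=.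
have -> : #|T|%:R * b = \sum_(t : T) b by rewrite sumr_const mulr_natl.
apply: ler_sum => t _; have [small|big] := ltrP #|part c t|%:R b.
  rewrite -natr_sum sum1_card; apply: le_trans (ltW small); rewrite ler_nat; apply: subset_leq_card.
  by apply/subsetP => x; rewrite !inE => /andP[_].
rewrite big_pred0 // => x; rewrite !inE.
by apply/negP => /andP[+ /eqP ct]; rewrite ct ltNge big.
Qed.

(** By the tower rule, the number of edges in the cells of density below [a] is the
    sum, over the points of those cells, of the density. *)
Lemma card_sparse_pairs (R : realType) (X T : finType) (A : rel X) (c : X -> T) (a : R) :
    0 <= a ->
  #|[set z : X * X | A z.1 z.2 &&
      (density (fun x y => (A x y)%:R : R) c (colour2 c z) < a)]|%:R
    <= a * #|X|%:R ^+ 2.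
Proof.
move=> a0; pose W x y : R := (A x y)%:R; rewrite -/W.
pose phi t : R := (density W c t < a)%R%:R.
have -> : #|[set z : X * X | A z.1 z.2 && (density W c (colour2 c z) < a)]|%:R
    = \sum_z density W c (colour2 c z) * phi (colour2 c z).
  rewrite [RHS](sum_average (colour2 c) _ phi) -sum1_card natr_sum big_mkcond /=.
  by apply: eq_bigr => z _; rewrite inE /W /phi -natrM mulnb; case: ifP.
have -> : a * #|X|%:R ^+ 2 = \sum_(z : X * X) a.
  by rewrite sumr_const card_prod -[in RHS]mulr_natl natrM; ring.
apply: ler_sum => z _; rewrite /phi; case: ltP => [/ltW|_]; by rewrite ?mulr1 ?mulr0.
Qed.

(** The graph on [V] is given by one orientation of each edge, and [A] need not be
    symmetric. *)
Theorem graph_removal (R : realType) (V : finType) (E : seq (V * V)) (eps : R) :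
    (forall e, e \in E -> e.1 != e.2) -> uniq [seq [set e.1; e.2] | e <- E] ->
    0 < eps ->
  exists2 delta : R, 0 < delta &
    forall (X : finType) (A : rel X), (0 < #|X|)%N ->
      #|[set y : {ffun V -> X} | hom_on A E y]|%:R < delta * #|X|%:R ^+ #|V| ->
    exists2 D : {set X * X}, #|D|%:R <= eps * #|X|%:R ^+ 2 &
      forall y, hom_on A E y -> has (fun e => (y e.1, y e.2) \in D) E.
Proof.
move=> loop uE eps0; set m := size E.
(* Each of the four sets making up [D] gets a quarter of [eps]. *)
pose a := Num.min 1 (eps / 4).
have a0 : 0 < a by rewrite lt_min ltr01 divr_gt0.
have a1 : a <= 1 by rewrite ge_min lexx.
have a4 : 4 * a <= eps by rewrite mulrC -ler_pdivlMr // ge_min lexx orbT.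
(* The errors of the [m] edges sum to at most half of [a ^+ m], which is a lower
   bound for the product of the densities. *)
pose e0 := a ^+ m / (2 * (m.+1)%:R).
have am0 : 0 < a ^+ m by rewrite exprn_gt0.
have e00 : 0 < e0 by rewrite divr_gt0 // mulr_gt0 // ltr0n.
have [M MP] := regularity_lemma e00 a0.
(* With at most [M] parts, those smaller than [b * #|X|] cover at most
   [a * #|X|] points. *)
pose b := a / (M.+1)%:R.
have b0 : 0 < b by rewrite divr_gt0 // ltr0n.
have b1 : b <= 1 by rewrite ler_pdivrMr ?ltr0n // mul1r (le_trans a1) // ler1n.
exists (b ^+ #|V| * (a ^+ m / 2)); first by rewrite mulr_gt0 ?exprn_gt0 ?divr_gt0.
move=> X A X0 few; pose W x y : R := (A x y)%:R.
have W01 x y : 0 <= W x y <= 1 by rewrite ler0n lern1 leq_b1.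
have [T [c [cT irr]]] := MP X W X0 W01.
set N : R := #|X|%:R in few irr *.
have N0 : 0 < N by rewrite ltr0n.
pose small := [set x | #|part c (c x)|%:R < b * N].
have smallN : #|small|%:R <= a * N.
  apply: (le_trans (card_small_parts c (b := b * N) _)); first by rewrite mulr_ge0 ?ltW.
  rewrite mulrA ler_pM2r // /b mulrCA ler_piMr ?ltW //.
  by rewrite ltr_pdivrMr ?ltr0n // mul1r ltr_nat ltnS.
pose sparse := [set z : X * X | A z.1 z.2 && (density W c (colour2 c z) < a)].
exists (irregular_pairs W e0 c :|: sparse :|: setX small setT :|: setX setT small).
  apply: (@le_trans _ _ (4 * a * N ^+ 2)); last by rewrite ler_wpM2r ?sqr_ge0.
  have cU (B1 B2 : {set X * X}) : #|B1 :|: B2|%:R <= #|B1|%:R + #|B2|%:R :> R.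
    by rewrite -natrD ler_nat leq_card_setU.
  have sp : #|sparse|%:R <= a * N ^+ 2 by apply: card_sparse_pairs; apply: ltW.
  have sN : #|small|%:R * N <= a * N ^+ 2 by rewrite expr2 mulrA ler_pM2r.
  have c1 : #|setX small [set: X]|%:R = #|small|%:R * N :> R by rewrite cardsX cardsT natrM.
  have c2 : #|setX [set: X] small|%:R = #|small|%:R * N :> R.
    by rewrite cardsX cardsT mulnC natrM.
  have := cU (irregular_pairs W e0 c) sparse.
  have := cU (irregular_pairs W e0 c :|: sparse) (setX small setT).
  have := cU (irregular_pairs W e0 c :|: sparse :|: setX small setT) (setX setT small).
  rewrite c1 c2; lra.
move=> y0 hom0; apply/negPn/negP; rewrite -all_predC => /allP avoid.
have {}avoid e : e \in E -> [/\ regular_pair W e0 (density W c (c (y0 e.1), c (y0 e.2)))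
      (part c (c (y0 e.1))) (part c (c (y0 e.2))),
    a <= density W c (c (y0 e.1), c (y0 e.2)),
    b * N <= #|part c (c (y0 e.1))|%:R & b * N <= #|part c (c (y0 e.2))|%:R].
  move=> eE; have := avoid e eE; have /allP/(_ e eE) /= Ae := hom0.
  by rewrite !inE /= Ae !andbT /= !negb_or !negbK -!leNgt => /andP[/andP[/andP[]]].
(* An isolated vertex may be mapped by [y0] into a small part, and is therefore
   allowed to go anywhere. *)
pose P u := if has (fun e => (u == e.1) || (u == e.2)) E then part c (c (y0 u)) else setT.
have PE e : e \in E -> P e.1 = part c (c (y0 e.1)) /\ P e.2 = part c (c (y0 e.2)).
  move=> eE; rewrite /P; split; case: hasP => //.
    by case; exists e => //; rewrite eqxx.
  by case; exists e => //; rewrite eqxx orbT.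
pose d u w := density W c (c (y0 u), c (y0 w)).
have d01 u w : 0 <= d u w <= 1 by apply: average_bounds => z; apply: W01.
have Pbig u : b * N <= #|P u|%:R.
  rewrite /P; case: hasP => [[e eE]|_]; last by rewrite cardsT ler_piMl // ltW.
  by have [_ _ P1 P2] := avoid e eE; case/orP => /eqP ->.
have := @counting_lemma R V X A e0 d P E (ltW e00) d01 loop uE.
have reg e : e \in E -> regular_pair W e0 (d e.1 e.2) (P e.1) (P e.2).
  by move=> eE; have [-> ->] := PE e eE; have [] := avoid e eE.
move=> /(_ reg); rewrite -/m ler_norml => /andP[+ _].
have Bbig : (b * N) ^+ #|V| <= #|box P|%:R.
  rewrite card_box natr_prod -prodr_const; apply: ler_prod => u _.
  by rewrite Pbig andbT mulr_ge0 // ltW.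
have dbig : a ^+ m <= \prod_(e <- E) d e.1 e.2.
  have -> : a ^+ m = \prod_(e <- E) a by rewrite big_const_seq count_predT iter_mulr_1.
  rewrite [X in X <= _]big_seq [X in _ <= X]big_seq; apply: ler_prod => e eE.
  by rewrite ltW //=; have [] := avoid e eE.
have few' : \sum_(y in box P) (hom_on A E y)%:R
    <= #|[set y : {ffun V -> X} | hom_on A E y]|%:R :> R.
  rewrite -sum1_card natr_sum big_mkcond [X in _ <= X]big_mkcond; apply: ler_sum => y _.
  by rewrite inE; case: (y \in box P); case: (hom_on A E y).
have me : m%:R * e0 <= a ^+ m / 2.
  rewrite /e0 invfM [a ^+ m * _]mulrA mulrCA ler_piMr ?divr_ge0 ?ltW //.
  by rewrite ltr_pdivrMr ?ltr0n // mul1r ltr_nat.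
move: Bbig few' few me dbig; rewrite exprMn.
set B := #|box P|%:R; set S := \sum_(y in _) _; set h := #|_|%:R; set p := \prod_(e <- E) _.
set q := b ^+ _; set n := N ^+ _ => Bbig few' few me dbig low.
have B0 : 0 <= B by [].
have qn : 0 < q * n by rewrite mulr_gt0 ?exprn_gt0.
have : q * n * (a ^+ m / 2) <= S.
  apply: (@le_trans _ _ (B * (a ^+ m / 2))); first by rewrite ler_pM2r ?divr_gt0.
  have : B * a ^+ m <= B * p by rewrite ler_wpM2l.
  have : m%:R * e0 * B <= a ^+ m / 2 * B by rewrite ler_wpM2r.
  lra.
lra.
Qed.

(** * Removal in Cayley graphs *)

Definition cayley (U : finZmodType) (f : U -> bool) : rel U := fun x y => f (y - x).

(** An element [x] is deleted when a fraction [1/k] of the edges [(z, z + x)] lies in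
    the set [D] of the removal lemma, [k] being the number of edges in [E].  The translates of a homomorphism are
    homomorphisms, and each of them must meet [D]. *)
Theorem cayley_removal (R : realType) (V : finType) (E : seq (V * V)) (eps : R) :
    (forall e, e \in E -> e.1 != e.2) -> uniq [seq [set e.1; e.2] | e <- E] ->
    0 < eps ->
  exists2 delta : R, 0 < delta &
    forall (U : finZmodType) (f : {ffun U -> bool}),
      #|[set y : {ffun V -> U} | hom_on (cayley f) E y]|%:R < delta * #|U|%:R ^+ #|V| ->
    exists2 g : {ffun U -> bool}, #|[set x | f x != g x]|%:R <= eps * #|U|%:R &
      forall y, ~~ hom_on (cayley g) E y.
Proof.
move=> loop uE eps0; set k := size E.
have k0 : 0 < k.+1%:R :> R by rewrite ltr0n.
have [delta delta0 deltaP] := graph_removal loop uE (divr_gt0 eps0 k0).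
exists delta => // U f few.
have U0 : (0 < #|U|)%N by apply/card_gt0P; exists 0.
have [D cD hitD] := deltaP U (cayley f) U0 few.
(* The translates of an edge of value [x] that lie in [D]. *)
pose diag x := [set z | (z, z + x) \in D].
have sum_diag : (\sum_x #|diag x| = #|D|)%N.
  rewrite -sum1_card (partition_big (fun p => p.2 - p.1) predT) //=.
  apply: eq_bigr => x _; rewrite sum1_card.
  have inj : injective (fun z => (z, z + x)) by move=> z z' [].
  rewrite -(card_imset _ inj); apply: eq_card => -[z z']; rewrite unfold_in /=.
  apply/imsetP/andP => [[t] | [zD /eqP <-]]; last first.
    by exists z; rewrite ?inE addrC subrK.
  by rewrite inE => tD [-> ->]; split => //; rewrite addrC addKr.
pose g := [ffun x => f x && (#|diag x| * k < #|U|)%N].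
exists g.
  pose B := [set x | (#|U| <= #|diag x| * k)%N].
  apply: (@le_trans _ _ #|B|%:R).
    rewrite ler_nat; apply: subset_leq_card; apply/subsetP => x.
    by rewrite !inE ffunE; case: (f x); case: ltnP.
  have UR : 0 < #|U|%:R :> R by rewrite ltr0n.
  rewrite -(ler_pM2r UR) -mulrA -expr2.
  apply: (@le_trans _ _ (#|D| * k)%:R).
    rewrite -natrM ler_nat -sum_diag big_distrl /= -sum_nat_const.
    by rewrite big_mkcond; apply: leq_sum => x _; rewrite inE; case: ifP.
  rewrite natrM; apply: (@le_trans _ _ (eps / k.+1%:R * #|U|%:R ^+ 2 * k.+1%:R)).
    by apply: ler_pM => //; rewrite ler_nat.
  by rewrite mulrAC divfK ?lt0r_neq0.
move=> y; apply/negP => /allP homy.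
have : (#|U| <= \sum_(e <- E) #|diag (y e.2 - y e.1)%R|)%N.
  have -> : (\sum_(e <- E) #|diag (y e.2 - y e.1)%R|
      = \sum_(z : U) \sum_(e <- E) (((y e.1 + z)%R, (y e.2 + z)%R) \in D))%N.
    rewrite exchange_big; apply: eq_bigr => e _ /=.
    rewrite -sum1_card big_mkcond (reindex_inj (addrI (y e.1))) /=.
    apply: eq_bigr => z _; rewrite inE addrAC addrCA subrr addr0 addrC.
    by case: ifP.
  rewrite -sum1_card; apply: leq_sum => z _.
  rewrite (eq_bigr (fun e => if (y e.1 + z, y e.2 + z) \in D then 1%N else 0%N)); last first.
    by move=> e _; case: ifP.
  rewrite -big_mkcond sum1_count -has_count.
  have /hitD : hom_on (cayley f) E [ffun u => y u + z].
    apply/allP => e /homy; rewrite /cayley !ffunE => /andP[+ _].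
    by rewrite opprD addrACA subrr addr0.
  by rewrite (eq_has (a2 := fun e => (y e.1 + z, y e.2 + z) \in D)) // => e; rewrite !ffunE.
rewrite leqNgt => /negP; apply.
have [E0|Epos] := posnP k.
  by move: U0; rewrite (size0nil E0) big_nil.
rewrite -(ltn_pmul2r Epos) big_distrl /=.
apply: (@leq_ltn_trans (\sum_(e <- E) #|U|.-1)%N).
  rewrite big_seq [X in (_ <= X)%N]big_seq; apply: leq_sum => e /homy.
  by rewrite /cayley ffunE => /andP[_ few_e]; rewrite -ltnS prednK.
by rewrite big_const_seq count_predT iter_addn_0 ltn_pmul2r // prednK.
Qed.

(** * Zero sums determined by dependent sets *)

Section ZeroSums.
Variables (I : finType).

Definition dependent (U : zmodType) (a : I -> U) (S : {set I}) : Prop :=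
  exists C : {set I}, [/\ C \subset S, C != set0 & \sum_(i in C) a i = 0].

(** A zero sum contains a minimal nonempty zero sum of [a], that is, a circuit of the
    dependence structure.  Since [b] has the same dependent sets, the circuit is
    a zero sum of [b] as well; remove it and induct. *)
Lemma zero_sum_transfer (U U' : zmodType) (a : I -> U) (b : I -> U') :
    (forall S, dependent a S <-> dependent b S) ->
  forall S : {set I}, \sum_(i in S) a i = 0 -> \sum_(i in S) b i = 0.
Proof.
move=> ab S; have [m] := ubnP #|S|; elim: m S => // m IH S Sm sumS.
have [->|S0] := eqVneq S set0; first by rewrite big_set0.
pose P := [pred C : {set I} | (C != set0) && (\sum_(i in C) a i == 0)].
have [C /minsetP[/andP[C0 /eqP sumC] minC] sCS] : {C | minset P C & C \subset S}.
  by apply: minset_exists; rewrite /= S0 sumS eqxx.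
have sumbC : \sum_(i in C) b i = 0.
  have /ab[C1 [sC1 C10 sumC1]] : dependent a C by exists C.
  have /ab[C2 [sC2 C20 sumC2]] : dependent b C1 by exists C1.
  have C2C : C2 = C.
    by apply: minC; [rewrite /= C20 sumC2 eqxx|apply: subset_trans sC1].
  by have -> : C = C1 by apply/eqP; rewrite eqEsubset sC1 andbT -{1}C2C.
have split (W : zmodType) (c : I -> W) :
    \sum_(i in S) c i = \sum_(i in C) c i + \sum_(i in S :\: C) c i.
  by rewrite (big_setID C) /= (setIidPr sCS).
rewrite split sumbC add0r; apply: IH; last first.
  by have := split _ a; rewrite sumS sumC add0r.
rewrite -ltnS; apply: leq_trans Sm; rewrite ltnS cardsD (setIidPr sCS).
by rewrite ltn_subrL !card_gt0 C0 S0.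
Qed.

Lemma F2_indicator (x : 'F_2) : x = (x != 0)%:R.
Proof. by case: x => -[|[|//]] lt; apply/val_inj. Qed.

(** Over the field with two elements a linear relation is determined by its
    support. *)
Lemma not_free_dependent (U : vectType 'F_2) (v : I -> U) (S : {set I}) :
  ~~ free [seq v i | i in S] <-> dependent v S.
Proof.
have kvE (c : 'I_#|S| -> 'F_2) (C : {set I}) :
    (forall j, c j = (enum_val j \in C)%:R) -> C \subset S ->
    \sum_(j < #|S|) c j *: (image_tuple v S)`_j = \sum_(i in C) v i.
  move=> cE sCS; rewrite (eq_bigr (fun j => (enum_val j \in C)%:R *: v (enum_val j))).
    rewrite -(big_enum_val (fun i => (i \in C)%:R *: v i)) /=.
    rewrite big_mkcond [RHS]big_mkcond; apply: eq_bigr => i _.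
    have := subsetP sCS i; case: (i \in C) => [->|_]; rewrite ?scale1r ?scale0r //.
    by case: ifP.
  by move=> j _; rewrite nth_image cE.
split=> [nf | [C [sCS C0 sumC]]]; last first.
  apply/negP => /(@freeP _ _ _ (image_tuple v S)) fr.
  have /set0Pn[i iC] := C0; have iS := subsetP sCS i iC.
  have := fr (fun j => (enum_val j \in C)%:R).
  rewrite (kvE _ C) // sumC => /(_ erefl (enum_rank_in iS i)) /eqP.
  by rewrite enum_rankK_in // iC oner_eq0.
have [c [sumc [j cj]]] : exists c : 'I_#|S| -> 'F_2,
    \sum_j c j *: (image_tuple v S)`_j = 0 /\ exists j, c j != 0.
  apply: contrapT => no; case/negP: nf; apply/(@freeP _ _ _ (image_tuple v S)) => c sumc j.
  by apply/eqP; apply: contrapT => /negP cj; apply: no; exists c; split=> //; exists j.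
pose C := [set enum_val j | j in [set j | c j != 0]].
have sCS : C \subset S by apply/subsetP => i /imsetP[k _ ->]; apply: enum_valP.
have cE k : c k = (enum_val k \in C)%:R.
  by rewrite (mem_imset _ _ enum_val_inj) inE -F2_indicator.
exists C; split=> //; last by rewrite -(kvE c C).
by apply/set0Pn; exists (enum_val j); rewrite imset_f // inE.
Qed.

End ZeroSums.

(** The zero sums of [a] are all its linear relations, so [b] satisfies every
    linear relation of [a]. *)
Lemma linear_extension (k m n : nat) (a : 'I_k -> 'rV['F_2]_m) (b : 'I_k -> 'rV['F_2]_n) :
    (forall S : {set 'I_k}, \sum_(i in S) a i = 0 -> \sum_(i in S) b i = 0) ->
  exists L : {linear 'rV['F_2]_m -> 'rV['F_2]_n}, forall i, L (a i) = b i.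
Proof.
move=> ab; pose A := \matrix_i a i; pose B := \matrix_i b i.
have kerAB (r : 'rV_k) : r *m A = 0 -> r *m B = 0.
  have rE p (c : 'I_k -> 'rV['F_2]_p) :
      r *m (\matrix_i c i) = \sum_(i in [set i | r 0 i != 0]) c i.
    rewrite mulmx_sum_row [RHS]big_mkcond; apply: eq_bigr => i _.
    by rewrite rowK inE [r 0 i in LHS]F2_indicator; case: (r 0 i != 0); rewrite ?scale1r ?scale0r.
  by rewrite !rE; apply: ab.
have AB : A *m (pinvmx A *m B) = B.
  apply/eqP; rewrite eq_sym -subr_eq0 -[X in X - _]mul1mx [A *m _]mulmxA -mulmxBl.
  apply/eqP/row_matrixP => i; rewrite row_mul row0; apply: kerAB.
  by rewrite -row_mul mulmxBl mul1mx mulmxKpV // subrr row0.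
exists (mulmxr (pinvmx A *m B)) => i /=.
by rewrite -[a i](rowK a) -row_mul -/A AB rowK.
Qed.

(** * Cycles and dependent sets of incidence vectors *)

Section CycleSpace.
Variables (V I : finType) (edge : I -> {set V}).
Hypotheses (edge_inj : injective edge) (edge2 : forall i, #|edge i| = 2%N).

Definition incidence (i : I) : 'rV['F_2]_#|V| :=
  \sum_(x in edge i) delta_mx 0 (enum_rank x).

Lemma sum_edge (U : zmodType) (y : V -> U) (i : I) (x x' : V) :
  edge i = [set x; x'] -> \sum_(u in edge i) y u = y x + y x'.
Proof.
move=> ei; have xx' : x != x' by have := edge2 i; rewrite ei cards2; case: eqP.
by rewrite ei big_setU1 ?inE //= big_set1.
Qed.

Lemma addF2_self (n : nat) (x : 'rV['F_2]_n) : x + x = 0.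
Proof. by apply/rowP => j; rewrite !mxE [x 0 j]F2_indicator; case: (x 0 j != 0); apply/val_inj. Qed.

Lemma next_next_neq (p : seq V) (x : V) :
  uniq p -> (2 < size p)%N -> x \in p -> next p (next p x) != x.
Proof.
move=> Up p2 /rot_to[i [|y [|z q]] rp].
- by have := congr1 size rp; rewrite size_rot /= => s; rewrite s in p2.
- by have := congr1 size rp; rewrite size_rot /= => s; rewrite s in p2.
have : uniq (rot i p) by rewrite rot_uniq.
rewrite -!(next_rot i Up) rp /= !inE !negb_or => /and4P[/and3P[xy xz _] /andP[yz _] _ _].
by rewrite eqxx (eq_sym y) (negPf xy) eqxx eq_sym.
Qed.

(** The edges of a cycle are pairwise distinct, and each vertex of the cycle is
    counted twice in the sum of their incidence vectors. *)
Lemma cycle_dependent (S : {set I}) :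
  contains_cycle (edge @: S) -> dependent incidence S.
Proof.
case=> p p2 /andP[cyc Up].
have [x0 x0p] : exists x, x \in p by case: p p2 {cyc Up} => // x p; exists x; rewrite mem_head.
have edgeP x : exists i, x \in p -> i \in S /\ edge i = [set x; next p x].
  have [xp|_] := boolP (x \in p).
    by have /imsetP[i iS ei] := next_cycle cyc xp; exists i.
  by have /imsetP[i iS ei] := next_cycle cyc x0p; exists i.
have [idx idxP] := fin_all_exists edgeP.
pose P := [set x in p].
have idx_inj : {in P &, injective idx}.
  move=> x x'; rewrite !inE => xp x'p eq_idx.
  have [_ ex] := idxP x xp; have [_ ex'] := idxP x' x'p.
  have : x \in edge (idx x') by rewrite -eq_idx ex set21.
  rewrite ex' !inE => /orP[/eqP //|/eqP xx'].
  have : x' \in edge (idx x) by rewrite eq_idx ex' set21.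
  rewrite ex !inE => /orP[/eqP //|/eqP x'x].
  by have := next_next_neq Up p2 xp; rewrite -x'x -xx' eqxx.
exists [set idx x | x in P]; split.
- by apply/subsetP => i /imsetP[x + ->]; rewrite inE => /idxP[].
- by apply/set0Pn; exists (idx x0); rewrite imset_f // inE.
rewrite big_imset //=; set delta := fun x : V => delta_mx 0 (enum_rank x) : 'rV['F_2]_#|V|.
transitivity (\sum_(x in P) (delta x + delta (next p x))).
  by apply: eq_bigr => x; rewrite inE => /idxP[_ ex]; apply: sum_edge.
rewrite big_split /= [X in X + _](reindex_inj (can_inj (prev_next Up))) /=.
rewrite (eq_bigl (mem P)); first exact: addF2_self.
by move=> x; rewrite !inE mem_next.
Qed.

(** In an even subgraph no vertex lies on exactly one edge: read off the coordinate
    [x] of the sum. *)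
Lemma even_degree (C : {set I}) (x : V) (i : I) :
    \sum_(j in C) incidence j = 0 -> i \in C -> x \in edge i ->
  exists j, [/\ j \in C, j != i & x \in edge j].
Proof.
move=> sumC iC xi; apply: contrapT => alone.
have coefE j : incidence j 0 (enum_rank x) = (x \in edge j)%:R.
  rewrite summxE; have [xj|xj] := boolP (x \in edge j).
    rewrite (bigD1 x) //= mxE !eqxx big1 ?addr0 // => u /andP[_ ux].
    by rewrite mxE (inj_eq enum_rank_inj) eq_sym (negPf ux) andbF.
  apply: big1 => u uj; rewrite mxE (inj_eq enum_rank_inj).
  by case: (eqVneq x u) xj => [->|]; rewrite ?uj ?andbF.
have /eqP := congr1 (fun r : 'rV__ => r 0 (enum_rank x)) sumC.
rewrite summxE mxE (bigD1 i) //= coefE xi big1 ?addr0 ?oner_eq0 // => j /andP[jC ji].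
rewrite coefE; case: (boolP (x \in edge j)) => // xj.
by case: alone; exists j.
Qed.

(** Take a longest path in an even subgraph.  Its first vertex [a] has a second edge
    [az] there; by maximality [z] lies on the path, and the path from [a] to [z]
    closes up to a cycle. *)
Lemma dependent_cycle (S : {set I}) :
  dependent incidence S -> contains_cycle (edge @: S).
Proof.
case=> C [sCS /set0Pn[i iC] sumC].
pose e := [rel x y | [set x; y] \in edge @: C].
pose P n := [exists t : n.-tuple V, uniq t && sorted e t].
have /cards2P[x [y [xy ei]]] := introT eqP (edge2 i).
have P2 : P 2.
  apply/existsP; exists [tuple x; y]; rewrite /= inE xy !andbT.
  by rewrite -ei imset_f.
have Pmax n : P n -> (n <= #|V|)%N.
  by case/existsP => t /andP[/card_uniqP + _]; rewrite size_tuple => <-; apply: max_card.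
case: (ex_maxnP (ex_intro (fun n => P n) 2%N P2) Pmax) => m /existsP[t /andP[Ut path_t]] maxm.
have := maxm 2%N P2; have := size_tuple t.
case: (tval t) Ut path_t => [|a [|b q]] //=; [by move=> _ _ <-|by move=> _ _ <-|].
move=> Ut /andP[ab path_q] sz _.
have /imsetP[j jC ej] := ab.
have aj : a \in edge j by rewrite -ej set21.
have [j' [j'C j'j aj']] := even_degree sumC jC aj.
have [z az ej'] : exists2 z, a != z & edge j' = [set a; z].
  have /cards2P[c [d [cd ecd]]] := introT eqP (edge2 j').
  move: aj'; rewrite ecd !inE => /orP[] /eqP ->; first by exists d.
  by exists c; rewrite 1?eq_sym // setUC.
have zb : z != b.
  by apply: contraNneq j'j => zb; apply/eqP/edge_inj; rewrite ej' zb ej.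
have ze : [set z; a] \in edge @: C by rewrite setUC -ej' imset_f.
have zq : z \in q.
  apply: contraT => zq.
  have : P m.+1.
    have szt : size [:: z, a, b & q] == m.+1 by rewrite /= -sz.
    apply/existsP; exists (Tuple szt); rewrite /= ze ab path_q andbT.
    rewrite !inE !negb_or (eq_sym z a) az zb zq andbT.
    by move: Ut; rewrite !inE !negb_or.
  by move=> /maxm; rewrite ltnn.
case/splitPr: zq Ut path_q => q1 q2 Ut path_q.
exists [:: a, b & rcons q1 z]; first by rewrite /= size_rcons.
rewrite /ucycle; apply/andP; split; last first.
  move: Ut; rewrite /= -cat_rcons !inE !mem_cat cat_uniq !negb_or.
  by case/and3P => /and3P[-> -> _] /andP[-> _] /andP[-> _].
have sub : subrel e (fun x y => [set x; y] \in edge @: S).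
  by move=> x1 y1 /=; apply/subsetP/imsetS.
have : cycle e [:: a, b & rcons q1 z].
  move: path_q; rewrite -cat_rcons cat_path => /andP[pq _].
  by rewrite /= ab rcons_path pq last_rcons.
by apply: sub_path.
Qed.

End CycleSpace.

(** * The tester *)

Section NonAdaptive.
Variable D : Type.

Fixpoint reject_if_all (s : seq D) : qalg D :=
  if s is x :: s' then Query x (fun b => if b then reject_if_all s' else Answer D true)
  else Answer D false.

Lemma run_reject_if_all (f : D -> bool) s : run f (reject_if_all s) = ~~ all f s.
Proof. by elim: s => //= x s IH; case: (f x). Qed.

Lemma queries_reject_if_all s : queries (reject_if_all s) = size s.
Proof. by elim: s => //= x s ->; rewrite maxn0. Qed.

End NonAdaptive.

Lemma graphic_edges (k : nat) (v : 'I_k -> 'rV['F_2]_k) :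
    graphic v ->
  exists (V : finType) (ends : 'I_k -> V * V),
    [/\ forall i, (ends i).1 != (ends i).2,
        injective (fun i => [set (ends i).1; (ends i).2])
      & forall S : {set 'I_k}, ~~ free [seq v i | i in S] <->
          contains_cycle ((fun i => [set (ends i).1; (ends i).2]) @: S)].
Proof.
case=> G [edge [edge_inj edgeE cycleE]].
have /fin_all_exists[ends endsP] (i : 'I_k) : exists p : G * G,
    adj p.1 p.2 /\ edge i = [set p.1; p.2].
  have : edge i \in edges G by rewrite -edgeE imset_f.
  by case/imsetP => p; rewrite inE => pp ->; exists p.
have eE : edge =1 (fun i => [set (ends i).1; (ends i).2]) by move=> i; case: (endsP i).
exists G, ends; split.
- move=> i; apply/negP => /eqP ii; have [] := endsP i.
  by rewrite ii adj_irr.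
- by move=> i j ij; apply: edge_inj; rewrite !eE.
- by move=> S; rewrite -(eq_imset _ eE).
Qed.

Section GraphicFree.
Variables (k : nat) (v : 'I_k -> 'rV['F_2]_k) (V : finType) (ends : 'I_k -> V * V).
Let edge i := [set (ends i).1; (ends i).2].
Hypotheses (loopless : forall i, (ends i).1 != (ends i).2) (edge_inj : injective edge).
Hypothesis cycleE : forall S : {set 'I_k},
  ~~ free [seq v i | i in S] <-> contains_cycle (edge @: S).

(** By [zero_sum_transfer] the vectors [v i] and the incidence vectors satisfy the
    same linear relations.  A potential defines a linear map on the incidence
    vectors, hence on the [v i]; conversely a linear map on the [v i] carries over
    to the incidence space, where it is given by its values on the vertices. *)
Lemma graphic_freeP (n : nat) (f : boolfun n) :
  matroid_free v f <->
  forall y : {ffun V -> 'rV['F_2]_n}, ~~ hom_on (cayley f) [seq ends i | i : 'I_k] y.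
Proof.
have edge2 i : #|edge i| = 2%N by rewrite cards2 loopless.
pose w := incidence edge.
have vw S : dependent v S <-> dependent w S.
  split=> [/not_free_dependent/cycleE|]; first exact: (cycle_dependent edge2).
  by move/(dependent_cycle edge_inj edge2)/cycleE/not_free_dependent.
have oppF2 (x : 'rV['F_2]_n) : - x = x.
  by apply/eqP; rewrite eq_sym -addr_eq0 addF2_self.
split=> [fr y | nohom L Lf].
  apply/negP => /allP homy.
  pose b i := y (ends i).2 - y (ends i).1.
  pose M := \matrix_(j < #|V|) y (enum_val j).
  have wM i : w i *m M = b i.
    rewrite mulmx_suml (eq_bigr y); last first.
      by move=> x _; rewrite -rowE rowK enum_rankK.
    by rewrite (sum_edge edge2 y (erefl (edge i))) /b oppF2 addrC.
  have [|L LE] := @linear_extension k k n v b.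
    move=> S /(zero_sum_transfer vw) sw.
    by rewrite (eq_bigr (fun i => w i *m M)) -?mulmx_suml ?sw ?mul0mx.
  apply: (fr L); apply: eq_from_tnth => i; rewrite !tnth_mktuple LE.
  by apply: homy; rewrite map_f ?mem_enum.
have [|L' L'E] := @linear_extension k #|V| n w (L \o v).
  move=> S /(zero_sum_transfer (fun S => iff_sym (vw S))) sv.
  by rewrite -linear_sum sv linear0.
pose y : {ffun V -> 'rV['F_2]_n} := [ffun u => L' (delta_mx 0 (enum_rank u))].
have /negP := nohom y; apply; apply/allP => e /mapP[i _ ->].
have -> : cayley f (y (ends i).1) (y (ends i).2) = f (L (v i)).
  rewrite /cayley -[L (v i)]L'E /w /incidence (sum_edge edge2 _ (erefl (edge i))).
  by rewrite linearD !ffunE oppF2 addrC.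
by have := congr1 (fun t => tnth t i) Lf; rewrite !tnth_mktuple.
Qed.

End GraphicFree.

Section PotentialTester.
Variables (R : realType) (V : finType) (E : seq (V * V)) (U : finZmodType) (q : nat).
Hypothesis sizeE : (size E <= q)%N.
Let coinsT := {ffun V -> U}.

Lemma uniform_ge0 (w : coinsT) : 0 <= #|{: coinsT}|%:R^-1 :> R.
Proof. by rewrite invr_ge0. Qed.

Lemma uniform_sum1 : \sum_(w : coinsT) (#|{: coinsT}|%:R^-1 : R) = 1.
Proof.
rewrite sumr_const -[LHS]mulr_natl mulfV // pnatr_eq0 -lt0n.
by apply/card_gt0P; exists [ffun=> 0].
Qed.

Lemma potential_queries (y : coinsT) :
  (queries (reject_if_all [seq (y e.2 - y e.1)%R | e <- E]) <= q)%N.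
Proof. by rewrite queries_reject_if_all size_map. Qed.

(** The [q]-query tester that draws a uniform potential and rejects when [f] holds at
    the difference along every edge. *)
Definition potential_tester : tester R U q :=
  Tester uniform_ge0 uniform_sum1 potential_queries.

Lemma run_potential_tester (f : U -> bool) y :
  run f (strategy potential_tester y) = ~~ hom_on (cayley f) E y.
Proof. by rewrite /= run_reject_if_all all_map. Qed.

Lemma potential_tester_accept (f : U -> bool) :
  (forall y : {ffun V -> U}, ~~ hom_on (cayley f) E y) ->
  pr_accept potential_tester f = 1.
Proof.
move=> nohom; rewrite /pr_accept -[RHS]uniform_sum1.
by apply: eq_bigl => y; rewrite run_potential_tester nohom.
Qed.

Lemma potential_tester_reject (f : U -> bool) :
  pr_reject potential_tester f
    = #|[set y : {ffun V -> U} | hom_on (cayley f) E y]|%:R / #|U|%:R ^+ #|V|.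
Proof.
rewrite /pr_reject (eq_bigl (mem [set y : {ffun V -> U} | hom_on (cayley f) E y])).
  by rewrite /= sumr_const -[LHS]mulr_natl card_ffun natrX.
by move=> y; rewrite run_potential_tester negbK /= in_set.
Qed.

End PotentialTester.

Theorem theorem1p1 (R : realType) (k : nat) (v : 'I_k -> 'rV['F_2]_k)
    (hv : graphic v) :
  exists tau : R -> R,
    (forall eps : R, 0 < eps -> 0 < tau eps) /\
    exists T : forall n : nat, tester R 'rV['F_2]_n k,
      forall n : nat, (0 < n)%N ->
      forall f : boolfun n,
        (matroid_free v f -> pr_accept (T n) f = 1) /\
        (forall eps : R, 0 < eps -> far eps f (matroid_free v (n := n)) ->
           tau eps <= pr_reject (T n) f).
Proof.
have [V [ends [loopless ends_inj cycleE]]] := graphic_edges hv.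
set E := [seq ends i | i : 'I_k].
have sizeE : (size E <= k)%N by rewrite size_map -cardE card_ord.
have loopE e : e \in E -> e.1 != e.2 by case/mapP => i _ ->.
have uniqE : uniq [seq [set e.1; e.2] | e <- E].
  by rewrite -map_comp map_inj_uniq ?enum_uniq.
have freeP n (f : boolfun n) := graphic_freeP loopless ends_inj cycleE f.
have /choice[tau tauP] (eps : R) : exists t : R, 0 < eps -> 0 < t /\
    forall (U : finZmodType) (f : {ffun U -> bool}),
      #|[set y : {ffun V -> U} | hom_on (cayley f) E y]|%:R < t * #|U|%:R ^+ #|V| ->
    exists2 g : {ffun U -> bool}, #|[set x | f x != g x]|%:R <= eps / 2 * #|U|%:R &
      forall y, ~~ hom_on (cayley g) E y.
  have [eps0|neps0] := boolP (0 < eps); last by exists 0.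
  have [delta delta0 deltaP] :=
    @cayley_removal R V E (eps / 2) loopE uniqE (divr_gt0 eps0 (ltr0n _ 2)).
  by exists delta.
exists tau; split=> [eps /tauP[]//|].
exists (fun n => potential_tester R 'rV['F_2]_n sizeE) => n _ f; split.
  by move=> /freeP; apply: potential_tester_accept.
move=> eps eps0 far_f; have [_ removal] := tauP eps eps0.
have N0 : 0 < #|{: 'rV['F_2]_n}|%:R :> R by rewrite ltr0n; apply/card_gt0P; exists 0.
rewrite potential_tester_reject ler_pdivlMr ?exprn_gt0 // leNgt; apply/negP => /removal.
case=> g close_g /freeP free_g.
have : dist_to R f (matroid_free v (n := n)) <= dist R f g.
  by apply: bigmin_le_cond; apply/asboolP.
apply/negP; rewrite -ltNge; apply: lt_le_trans far_f.
apply: (@le_lt_trans _ _ (eps / 2)); first by rewrite ler_pdivrMr.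
by rewrite ltr_pdivrMr // ltr_pMr // ltr1n.
Qed.
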